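(* Two right fountain triangulations $R_1$ and $R_2$ of $\mathbb{N}$ (with fountain point $0$) satisfy $R_1\sim R_2$ if and only if the sequences $\boldsymbol{x}^{R_1}$ and $\boldsymbol{x}^{R_2}$ differ in only finitely many places.
   Context: Arcs are pairs $(a,b)$ of integers with $0\le a<b$; arcs $(a,b),(c,d)$ cross if $a<c<b<d$ or $c<a<d<b$. A triangulation of $\mathbb{N}$ is a maximal set of pairwise noncrossing arcs. A right fountain triangulation with fountain point $0$ is such a triangulation $R$ containing $(0,n)$ for infinitely many $n$. $\boldsymbol{x}^R_n=1$ if $(0,n+1)\in R$ and $0$ otherwise ($n\ge1$); $\boldsymbol{y}^R_n$ is the $(n+1)$-st positive integer $\ell$ with $(0,\ell)\in R$. Mutation at a non-boundary arc $\gamma\in R$: replace $\gamma$ by the other diagonal of the unique quadrilateral of $R$ having $\gamma$ as diagonal. $R_1\sim R_2$ means $R_1$ can be mutated into $R_2$ using only finitely many mutations at arcs of the form $(0,\boldsymbol{y}_n)$ or $(\boldsymbol{y}_n,\boldsymbol{y}_{n+1})$ (of the current triangulation) and possibly infinitely many mutations at other arcs. *)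

(* Defs.v *)
From mathcomp Require Import all_boot all_order.
From mathcomp Require Import boolp classical_sets cardinality.

Set Implicit Arguments.
Unset Strict Implicit.
Unset Printing Implicit Defensive.

Local Open Scope classical_set_scope.

Definition arcs : set (nat * nat) := [set g | g.1 < g.2].

Definition crossing (g h : nat * nat) : Prop :=
  let: (a, b) := g in let: (c, d) := h in
  [/\ a < c, c < b & b < d] \/ [/\ c < a, a < d & d < b].

Definition noncrossing (R : set (nat * nat)) : Prop :=
  forall g h, R g -> R h -> ~ crossing g h.

Definition triangulation (R : set (nat * nat)) : Prop :=
  [/\ R `<=` arcs, noncrossing R
    & forall S : set (nat * nat),
        S `<=` arcs -> noncrossing S -> R `<=` S -> S = R].

Definition right_fountain (R : set (nat * nat)) : Prop :=
  triangulation R /\ infinite_set [set n | R (0, n)].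

Definition xseq (R : set (nat * nat)) (n : nat) : nat :=
  if `[< R (0, n.+1) >] then 1 else 0.

(* The (n+1)-st positive l with (0, l) in R, i.e. the one preceded by exactly
   n others; thus yseq R 0 = 1. It exists for every n when R is a right
   fountain triangulation; the default 0 of xget is then never used. *)
Definition yseq (R : set (nat * nat)) (n : nat) : nat :=
  xget 0 [set l | [/\ 0 < l, R (0, l)
                    & \sum_(1 <= k < l) `[< R (0, k) >] = n]].

Definition quadrilateral (R : set (nat * nat)) (a b c d : nat) : Prop :=
  [/\ a < b, b < c & c < d] /\ [/\ R (a, b), R (b, c), R (c, d) & R (a, d)].

(* A diagonal of a quadrilateral is never a boundary arc (i, i + 1). *)
Definition mutation (R : set (nat * nat)) (g : nat * nat)
    (R' : set (nat * nat)) : Prop :=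
  R g /\
  exists a b c d : nat, quadrilateral R a b c d /\
  exists g' : nat * nat,
    (g = (a, c) /\ g' = (b, d) \/ g = (b, d) /\ g' = (a, c)) /\
    R' = (R `\ g) `|` [set g'].

Definition fountain_arc (R : set (nat * nat)) (g : nat * nat) : Prop :=
  exists n, g = (0, yseq R n) \/ g = (yseq R n, yseq R n.+1).

(* T is the sequence of triangulations and m k the arc mutated at step k;
   steps with m k = None do nothing, so that finite sequences of mutations are
   covered as well as infinite ones. *)
Definition mutation_sequence (T : nat -> set (nat * nat))
    (m : nat -> option (nat * nat)) : Prop :=
  forall k, match m k with
            | Some g => mutation (T k) g (T k.+1)
            | None => T k.+1 = T k
            end.

(* The result of a possibly infinite sequence of mutations: membership of each
   individual pair is eventually constant. *)
Definition converges_to (T : nat -> set (nat * nat))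
    (R : set (nat * nat)) : Prop :=
  forall g, exists N, forall k, N <= k -> (T k g <-> R g).

Definition mutation_sim (R1 R2 : set (nat * nat)) : Prop :=
  exists (T : nat -> set (nat * nat)) (m : nat -> option (nat * nat)),
  [/\ T 0 = R1, mutation_sequence T m, converges_to T R2
    & finite_set [set k | exists2 g, m k = Some g & fountain_arc (T k) g]].

(* Main.v *)
(** Only a mutation at a fountain arc can change the set of arcs (0, n): an arc
(0, l) can appear only as the new diagonal of a quadrilateral 0, b, l, d, where
(b, d) joins consecutive fan points. So finitely many such mutations alter
finitely many terms of x.

Conversely, let the arcs (0, n) of R1 and R2 agree for n > N, and cut the line at 0, at
some fan point M > N and at all later fan points. Each resulting polygon [p, q]
is triangulated by R1 and by R2; triangulations of a polygon correspond to
binary trees and flips to rotations, and every tree can be rotated to a comb.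
Hence R1 becomes R2 block by block, finitely many flips each, and beyond the
first block no flip is at a fountain arc. *)

Require Import Defs.
From mathcomp Require Import all_boot all_order.
From mathcomp Require Import boolp classical_sets cardinality.
From mathcomp Require Import zify.

Set Implicit Arguments.
Unset Strict Implicit.
Unset Printing Implicit Defensive.

Local Open Scope classical_set_scope.

(** * Noncrossing sets, mutations and the arcs at [0] *)

Lemma crossingE a b c d : crossing (a, b) (c, d) =
  ([&& a < c, c < b & b < d] || [&& c < a, a < d & d < b]) :> Prop.
Proof.
apply/propext; split=> [[[-> -> ->]|[-> -> ->]]//|]; first by rewrite orbT.
by case/orP => /and3P[]; [left|right].
Qed.

Lemma crossing_sym g h : crossing g h -> crossing h g.
Proof. by case: g h => ? ? [? ?]; rewrite !crossingE; lia. Qed.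

(** An arc that crosses one diagonal of a quadrilateral but none of its sides is the other diagonal,
    and that one has just been removed. *)
Lemma mutation_noncrossing (R R' : set (nat * nat)) g :
  R `<=` arcs -> noncrossing R -> mutation R g R' ->
  R' `<=` arcs /\ noncrossing R'.
Proof.
move=> Rarc Rnc [Rg [a [b [c [d [[[ab bc cd] [Rab Rbc Rcd Rad]]]]]]]].
case=> g' [gg' ->].
have g'arc : arcs g' by case: gg' => -[_ ->]; rewrite /arcs /=; lia.
have key h : R h -> h <> g -> ~ crossing h g'.
  case: h => u v Rh hg; have uv : u < v := Rarc _ Rh.
  have hg' w z : g = (w, z) -> ~ (u = w /\ v = z).
    by move=> gE [uw vz]; apply: hg; rewrite gE uw vz.
  have := Rnc _ _ Rh Rab; have := Rnc _ _ Rh Rbc.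
  have := Rnc _ _ Rh Rcd; have := Rnc _ _ Rh Rad.
  by case: gg' => -[/hg' gE g'E]; rewrite g'E !crossingE; lia.
split=> [h [[/Rarc//]|-> //]|h k].
case=> [[Rh hg]|->]; case=> [[Rk kg]|->].
- exact: Rnc.
- exact: key.
- by move/crossing_sym; exact: key.
- by case: g' {gg' g'arc key} => u v; rewrite crossingE; lia.
Qed.

Definition fancount (R : set (nat * nat)) (l : nat) : nat :=
  \sum_(1 <= k < l) `[< R (0, k) >].

(** This strict growth makes the point that [xget] selects in [yseq] unique. *)
Lemma fancount_lt (R : set (nat * nat)) l l' :
  0 < l -> R (0, l) -> l < l' -> fancount R l < fancount R l'.
Proof.
move=> l0 Rl ll'; rewrite /fancount (big_cat_nat (n := l) (p := l')) //=; try lia.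
by rewrite (big_ltn ll') (asboolT Rl); lia.
Qed.

Lemma yseqE (R : set (nat * nat)) l :
  0 < l -> R (0, l) -> yseq R (fancount R l) = l.
Proof.
move=> l0 Rl; rewrite /yseq; case: xgetP => [k _ [k0 Rk ck]|/(_ l) []//].
have := fancount_lt l0 Rl; have := fancount_lt k0 Rk.
have [kl|lk|//] := ltngtP k l.
  by move=> /(_ _ kl); rewrite -/(fancount R k) in ck; lia.
by move=> _ /(_ _ lk); rewrite -/(fancount R k) in ck; lia.
Qed.

Lemma fancount_next (R : set (nat * nat)) b d :
  0 < b -> b < d -> R (0, b) -> (forall k, b < k < d -> ~ R (0, k)) ->
  fancount R d = (fancount R b).+1.
Proof.
move=> b0 bd Rb nR; rewrite /fancount (big_cat_nat (n := b) (p := d)) //=; try lia.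
rewrite (big_ltn bd) (asboolT Rb) [X in _ + (_ + X)]big_nat.
rewrite [X in _ + (_ + X)]big1 ?addn0 ?addn1 // => k bk.
by rewrite asboolF //; exact: nR.
Qed.

Lemma mutation_fan (R R' : set (nat * nat)) g :
  R `<=` arcs -> noncrossing R -> mutation R g R' -> ~ fountain_arc R g ->
  forall n, R' (0, n) <-> R (0, n).
Proof.
move=> Rarc Rnc [Rg [a [b [c [d [[[ab bc cd] [Rab Rbc Rcd Rad]]]]]]]].
case=> g' [gg' ->] nf n.
have gn0 l : g <> (0, l).
  move=> gE; apply: nf; subst g; exists (fancount R l); left.
  by rewrite yseqE //; exact: (Rarc _ Rg).
have g'n0 l : g' <> (0, l).
  move=> g'E; case: gg' => -[gE g'E']; first by move: g'E; rewrite g'E'; case; lia.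
  move: g'E; rewrite g'E' => -[a0 _]; subst a g; apply: nf.
  exists (fancount R b); right; rewrite yseqE // -(@fancount_next _ _ d) //; try lia.
    rewrite yseqE //; lia.
  (* A fan point strictly between [b] and [d] would give an arc crossing the removed diagonal
     [(b, d)], so [b] and [d] are consecutive. *)
  by move=> k bkd Rk; apply: (Rnc _ _ Rk Rg); rewrite crossingE; lia.
split=> [[[]//|]|Rn]; first by move=> /esym /g'n0.
by left; split=> // /esym /gn0.
Qed.

Lemma mutation_diff (R R' : set (nat * nat)) g :
  mutation R g R' -> exists g', R' `\ g' `<=` R /\ R `\ g `<=` R'.
Proof.
by case=> _ [a [b [c [d [_ [g' [_ ->]]]]]]]; exists g'; split=> h; [case=> [[[]|]]|left].
Qed.

Lemma finite_nat_bound (A : set nat) :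
  finite_set A <-> exists N, forall n, A n -> n < N.
Proof.
split=> [/finite_seqP[s ->]|[N AN]].
  exists (\max_(i <- s) i).+1 => n /= ns; rewrite ltnS.
  exact: (@leq_bigmax_seq _ s xpredT id).
exact: (@sub_finite_set _ _ `I_N).
Qed.

(** * Binary trees, rotations and flips in a polygon *)

Inductive btree := Leaf | Node of btree & btree.

Fixpoint leaves t := if t is Node l r then leaves l + leaves r else 1.

(* The triangulation, dual to t, of the polygon with vertices
   p, p + 1, ..., p + leaves t: every subtree contributes the arc spanning its
   leaves, so that rotations of t are flips. *)
Fixpoint tree_arcs (t : btree) (p : nat) : set (nat * nat) :=
  [set (p, p + leaves t)] `|`
  if t is Node l r then tree_arcs l p `|` tree_arcs r (p + leaves l) else set0.

Inductive rotation : btree -> btree -> Prop :=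
| RotRight a b c : rotation (Node (Node a b) c) (Node a (Node b c))
| RotLeft a b c : rotation (Node a (Node b c)) (Node (Node a b) c)
| RotInl l l' r : rotation l l' -> rotation (Node l r) (Node l' r)
| RotInr l r r' : rotation r r' -> rotation (Node l r) (Node l r').

Definition within (p q : nat) : set (nat * nat) :=
  [set g | [&& p <= g.1, g.1 < g.2 & g.2 <= q]].

(** The outer side [(p, q)] is excluded because, between positive consecutive fan points, it is the
    only arc of the block that can be a fountain arc. *)
Definition flip (p q : nat) (R R' : set (nat * nat)) : Prop :=
  (exists g, [/\ mutation R g R', within p q g & g <> (p, q)]) /\
  (forall h, ~ within p q h -> (R h <-> R' h)).

Lemma leaves_gt0 t : 0 < leaves t.
Proof. by elim: t => //= l hl r hr; lia. Qed.

Lemma leaves_rotation t t' : rotation t t' -> leaves t = leaves t'.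
Proof. by elim=> /=; lia. Qed.

Lemma tree_arcs_within t p : tree_arcs t p `<=` within p (p + leaves t).
Proof.
elim: t p => [|l IHl r IHr] p g /=; rewrite /within /=.
  by case=> // -> /=; lia.
have := leaves_gt0 l; have := leaves_gt0 r.
move=> ? ? [->|[/IHl|/IHr]]; rewrite /within /=; lia.
Qed.

Lemma tree_arcs_root t p : tree_arcs t p (p, p + leaves t).
Proof. by case: t => [|l r]; left. Qed.

Lemma rotation_sym t t' : rotation t t' -> rotation t' t.
Proof.
by elim=> *; [apply: RotLeft|apply: RotRight|apply: RotInl|apply: RotInr].
Qed.

Lemma quadrilateral_mutation (U : set (nat * nat)) a b c d g g' :
  quadrilateral U a b c d ->
  g = (a, c) /\ g' = (b, d) \/ g = (b, d) /\ g' = (a, c) ->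
  ~ U g -> mutation (U `|` [set g]) g (U `|` [set g']).
Proof.
move=> [abcd [Uab Ubc Ucd Uad]] gg' nUg; split; first by right.
exists a, b, c, d; split; first by split=> //; split; left.
exists g'; split=> //; congr (_ `|` _); apply/seteqP; split=> h.
  by move=> Uh; split; [left|move=> hg; apply: nUg; rewrite -hg].
by case=> -[].
Qed.

(** The two trees differ in a single arc, the diagonal of a quadrilateral whose sides span subtrees.
    The context [C] is arbitrary so that the induction can descend into a subtree. *)
Lemma rotation_flip t t' p (C : set (nat * nat)) :
  rotation t t' -> (forall g, C g -> ~ within p (p + leaves t) g) ->
  flip p (p + leaves t) (C `|` tree_arcs t p) (C `|` tree_arcs t' p).
Proof.
move=> tt' Cout; split; last first.
  move=> h nh; split=> -[Ch|th]; try (by left); exfalso; apply: nh.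
    exact: tree_arcs_within th.
  by rewrite (leaves_rotation tt'); exact: tree_arcs_within th.
(* Rotation at the root, at any position [q]: [U] collects the arcs common to both sides, and [g],
   [g'] are the two diagonals. *)
have base a b c q D (U := D `|` [set (q, q + (leaves a + leaves b + leaves c))]
      `|` tree_arcs a q `|` tree_arcs b (q + leaves a)
      `|` tree_arcs c (q + leaves a + leaves b))
    (g := (q, q + leaves a + leaves b))
    (g' := (q + leaves a, q + leaves a + leaves b + leaves c)) :
    (forall h, D h -> ~ within q (q + (leaves a + leaves b + leaves c)) h) ->
    [/\ D `|` tree_arcs (Node (Node a b) c) q = U `|` [set g],
       D `|` tree_arcs (Node a (Node b c)) q = U `|` [set g'],
       ~ U g, ~ U g' & quadrilateral U q (q + leaves a) (q + leaves a + leaves b)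
         (q + leaves a + leaves b + leaves c)].
  move=> Dout.
  have := leaves_gt0 a; have := leaves_gt0 b; have := leaves_gt0 c => c0 b0 a0.
  have UE h : U h = (D h \/ h = (q, q + (leaves a + leaves b + leaves c)) \/
      tree_arcs a q h \/ tree_arcs b (q + leaves a) h \/
      tree_arcs c (q + leaves a + leaves b) h).
    by apply/propext; rewrite /U /setU /=; tauto.
  split.
  - by apply/funext => h; apply/propext;
      rewrite /= /setU /set1 /mkset UE !addnA /g /g'; tauto.
  - by apply/funext => h; apply/propext;
      rewrite /= /setU /set1 /mkset UE !addnA /g /g'; tauto.
  - rewrite UE => -[/Dout|[[]|[/tree_arcs_within|[]/tree_arcs_within]]];
      rewrite /within /=; lia.
  - rewrite UE => -[/Dout|[[]|[/tree_arcs_within|[]/tree_arcs_within]]];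
      rewrite /within /=; lia.
  - split; first by split; lia.
    by split; rewrite UE; have := tree_arcs_root; rewrite ?addnA; auto 6.
elim: tt' p C Cout => {t t'} [a b c|a b c|l l' r ll' IH|l r r' rr' IH] p C Cout.
- have [-> -> nUg _ quad] := base _ _ _ _ _ Cout.
  exists (p, p + leaves a + leaves b); split.
  + by apply: quadrilateral_mutation quad _ nUg; left.
  + rewrite /within /=; have := leaves_gt0 a; lia.
  + by case; have := leaves_gt0 c; lia.
- rewrite [leaves _]/= (addnA (leaves a)) in Cout *.
  have [-> -> _ nUg quad] := base _ _ _ _ _ Cout.
  exists (p + leaves a, p + leaves a + leaves b + leaves c); split.
  + by apply: quadrilateral_mutation quad _ nUg; right.
  + rewrite /within /=; have := leaves_gt0 b; lia.
  + by case; have := leaves_gt0 a; lia.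
- have r0 := leaves_gt0 r; have l0 := leaves_gt0 l.
  (* The root arc and the arcs of the untouched sibling join the context. *)
  pose D := C `|` [set (p, p + (leaves l + leaves r))] `|` tree_arcs r (p + leaves l).
  have [|g [mg wg gn]] := IH p D.
    move=> g [[/Cout|->]|/tree_arcs_within]; rewrite /within /=; lia.
  have DE k : leaves k = leaves l -> C `|` tree_arcs (Node k r) p = D `|` tree_arcs k p.
    move=> kl; apply/funext => h; apply/propext.
    by rewrite /D /= kl /setU /set1 /mkset; tauto.
  rewrite !DE ?(leaves_rotation ll') //.
  exists g; split=> //; first by move: wg; rewrite /within /=; lia.
  by move=> gE; move: wg; rewrite gE /within /=; lia.
- have r0 := leaves_gt0 r; have l0 := leaves_gt0 l.
  pose D := C `|` [set (p, p + (leaves l + leaves r))] `|` tree_arcs l p.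
  have [|g [mg wg gn]] := IH (p + leaves l) D.
    move=> g [[/Cout|->]|/tree_arcs_within]; rewrite /within /=; lia.
  have DE k : leaves k = leaves r ->
      C `|` tree_arcs (Node l k) p = D `|` tree_arcs k (p + leaves l).
    move=> kr; apply/funext => h; apply/propext.
    by rewrite /D /= kr /setU /set1 /mkset; tauto.
  rewrite !DE ?(leaves_rotation rr') //.
  exists g; split=> //; first by move: wg; rewrite /within /=; lia.
  by move=> gE; move: wg; rewrite gE /within /=; lia.
Qed.

(** * Finite paths and connectivity of the triangulations of a polygon *)

(** Reflexive transitive closure, witnessed by a list so that [reach_concat] can replay the path
    step by step. *)
Definition reach (T : Type) (E : T -> T -> Prop) (x y : T) : Prop :=
  exists2 s : seq T, path (fun a b => `[< E a b >]) x s & last x s = y.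

Lemma reach_refl T (E : T -> T -> Prop) x : reach E x x.
Proof. by exists [::]. Qed.

Lemma reach_trans T (E : T -> T -> Prop) y x z :
  reach E x y -> reach E y z -> reach E x z.
Proof.
move=> [s sp sl] [s' sp' sl']; exists (s ++ s'); first by rewrite cat_path sp sl.
by rewrite last_cat sl.
Qed.

Lemma reach1 T (E : T -> T -> Prop) x y : E x y -> reach E x y.
Proof. by move=> xy; exists [:: y] => //=; rewrite andbT; apply/asboolP. Qed.

Lemma reach_ind T (E : T -> T -> Prop) (P : T -> T -> Prop) :
  (forall x, P x x) -> (forall x y z, E x y -> reach E y z -> P y z -> P x z) ->
  forall x y, reach E x y -> P x y.
Proof.
move=> P0 PS x y [s]; elim: s x => [|z s IH] x /=; first by move=> _ <-.
move=> /andP[/asboolP xz zs] sy; apply: PS xz _ _; first by exists s.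
exact: IH.
Qed.

Lemma reach_sym T (E : T -> T -> Prop) : (forall x y, E x y -> E y x) ->
  forall x y, reach E x y -> reach E y x.
Proof.
move=> Es; apply: reach_ind; first exact: reach_refl.
move=> x y z xy _ zy; apply: reach_trans zy _.
by apply: reach1; exact: Es.
Qed.

Lemma reach_map T T' (E : T -> T -> Prop) (E' : T' -> T' -> Prop) (f : T -> T') :
  (forall x y, E x y -> E' (f x) (f y)) ->
  forall x y, reach E x y -> reach E' (f x) (f y).
Proof.
move=> fE; apply: reach_ind => [x|x y z xy _]; first exact: reach_refl.
by apply: reach_trans; apply: reach1; exact: fE.
Qed.

Fixpoint comb n := if n is n'.+1 then Node Leaf (comb n') else Leaf.

Lemma rotation_comb t : reach rotation t (comb (leaves t).-1).
Proof.
elim: t => [|l IHl r IHr] /=; first exact: reach_refl.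
apply: reach_trans (reach_map (fun x y => @RotInl x y r) IHl) _.
apply: reach_trans (reach_map (fun x y => @RotInr (comb (leaves l).-1) x y) IHr) _.
have -> : (leaves l + leaves r).-1 = ((leaves l).-1 + (leaves r).-1).+1.
  by have := leaves_gt0 l; have := leaves_gt0 r; lia.
(* With both subtrees combed, each right rotation detaches one leaf from the left comb; the rest is
   merged below it. *)
elim: (leaves l).-1 => [|n IHn]; first exact: reach_refl.
apply: reach_trans (reach1 (RotRight _ _ _)) _.
exact: (reach_map (fun x y => @RotInr Leaf x y)).
Qed.

Lemma rotation_connected t t' : leaves t = leaves t' -> reach rotation t t'.
Proof.
move=> tt'; apply: reach_trans (rotation_comb t) _; rewrite tt'.
exact: reach_sym rotation_sym _ _ (rotation_comb t').
Qed.

Definition tree_on (t : btree) (p q : nat) (R : set (nat * nat)) : Prop :=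
  p + leaves t = q /\ forall g, within p q g -> (R g <-> tree_arcs t p g).

(** Both sets are the same context [C] outside the polygon plus the arcs of a tree, so a path of
    rotations lifts to a path of flips. *)
Lemma polygon_flip_connected t t' p q (R R' : set (nat * nat)) :
  tree_on t p q R -> tree_on t' p q R' ->
  (forall g, ~ within p q g -> (R g <-> R' g)) -> reach (flip p q) R R'.
Proof.
move=> [tq Rt] [t'q Rt'] off; have tt' : leaves t = leaves t' by lia.
pose C := R `\` within p q.
have RE : R = C `|` tree_arcs t p.
  apply/funext => h; apply/propext; have := Rt h; have := @tree_arcs_within t p h.
  by rewrite tq /C /setU /setD /mkset; have := pselect (within p q h); tauto.
have RE' : R' = C `|` tree_arcs t' p.
  apply/funext => h; apply/propext; have := Rt' h; have := @tree_arcs_within t' p h.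
  rewrite t'q /C /setU /setD /mkset; have := pselect (within p q h).
  by have := off h; tauto.
rewrite {}RE {}RE'; have := rotation_connected tt'; move: t t' tq tt' {Rt Rt' t'q}.
suff H t t' : reach rotation t t' -> p + leaves t = q ->
    reach (flip p q) (C `|` tree_arcs t p) (C `|` tree_arcs t' p).
  by move=> t t' tq _ /H; exact.
move: t t'; apply: reach_ind => [t _|t u v tu _ IH tq]; first exact: reach_refl.
apply: reach_trans (IH _); last by rewrite -(leaves_rotation tu).
by apply: reach1; rewrite -tq; apply: rotation_flip => // g [_]; rewrite tq.
Qed.

(** * The part of a triangulation lying under an arc *)

(** Adjoining the arc keeps the set noncrossing, so by maximality it was already there. *)
Lemma triangulation_mem (R : set (nat * nat)) a b : triangulation R -> a < b ->
  (forall h, R h -> ~ crossing (a, b) h) -> R (a, b).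
Proof.
move=> [Rarc Rnc Rmax] ab nab.
rewrite -(Rmax (R `|` [set (a, b)])); first by right.
- by move=> h [/Rarc|->].
- move=> h k [Rh|->] [Rk|->]; [exact: Rnc| | exact: nab|rewrite crossingE; lia].
  by move/crossing_sym; exact: nab.
- by move=> h; left.
Qed.

Lemma triangulation_boundary (R : set (nat * nat)) a :
  triangulation R -> R (a, a.+1).
Proof.
move=> Rt; apply: triangulation_mem => // -[u v] _; rewrite crossingE; lia.
Qed.

(** An arc crossing [(c, q)] either crosses [(p, q)] or [(p, c)], or joins [p] to a point strictly
    between [c] and [q]. *)
Lemma triangulation_triangle (R : set (nat * nat)) p c q :
  triangulation R -> R (p, q) -> R (p, c) -> c < q ->
  (forall k, c < k < q -> ~ R (p, k)) -> R (c, q).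
Proof.
move=> Rt Rpq Rpc cq nR; have [Rarc Rnc _] := Rt.
apply: triangulation_mem => // -[u v] Ruv.
have pc : p < c := Rarc _ Rpc; have uv : u < v := Rarc _ Ruv.
have := Rnc _ _ Rpq Ruv; have := Rnc _ _ Rpc Ruv; rewrite !crossingE.
have : ~ (u = p /\ c < v < q) by case=> uE cv; apply: (nR v cv); rewrite -uE.
lia.
Qed.

Lemma last_before (P : nat -> Prop) a b : a < b -> P a ->
  exists c, [/\ a <= c < b, P c & forall k, c < k < b -> ~ P k].
Proof.
move=> ab Pa.
pose Q c := `[< P c >] && (a <= c < b).
have exQ : exists c, Q c by exists a; rewrite /Q (asboolT Pa) leqnn ab.
have Qb c : Q c -> c <= b by rewrite /Q; lia.
case: (ex_maxnP exQ Qb) => c /andP[/asboolP Pc ac] cmax; exists c; split=> //.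
move=> k ckb Pk; have : Q k by rewrite /Q (asboolT Pk); lia.
by move/cmax; lia.
Qed.

Lemma triangulation_tree (R : set (nat * nat)) p q :
  triangulation R -> R (p, q) -> exists t, tree_on t p q R.
Proof.
move=> Rt; have [n] := ubnP (q - p); elim: n p q => // n IH p q qpn Rpq.
have [Rarc Rnc _] := Rt; have pq : p < q := Rarc _ Rpq.
have [pq1|pq1] := eqVneq q p.+1.
  exists Leaf; split; first by rewrite /=; lia.
  move=> [u v] wuv /=; have [-> ->] : u = p /\ v = p + 1.
    by move: wuv; rewrite /within /=; lia.
  by rewrite addn1 -pq1; split=> // _; left.
(* The last neighbour [c] of [p] before [q] is the apex of the triangle on [(p, q)]; it splits the
   tree at its root. *)
have [||c [pcq Rpc cmax]] := @last_before (fun c => R (p, c)) p.+1 q.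
- lia.
- exact: triangulation_boundary.
have Rcq : R (c, q) by apply: triangulation_triangle Rt Rpq Rpc _ cmax; lia.
have [l [lc lE]] : exists t, tree_on t p c R by apply: IH => //; lia.
have [r [rc rE]] : exists t, tree_on t c q R by apply: IH => //; lia.
exists (Node l r); split=> [/=|[u v] wuv]; first lia.
rewrite /= lc addnA lc rc /setU /set1 /mkset.
have lw := @tree_arcs_within l p (u, v); rewrite lc in lw.
have rw := @tree_arcs_within r c (u, v); rewrite rc in rw.
have [wl|nwl] := pselect (within p c (u, v)).
  have := lE _ wl.
  have : ~ tree_arcs r c (u, v) by move/rw; move: wl; rewrite /within /=; lia.
  have : (u, v) <> (p, q) by case; move: wl; rewrite /within /=; lia.
  tauto.
have [wr|nwr] := pselect (within c q (u, v)).
  have := rE _ wr.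
  have : ~ tree_arcs l p (u, v) by move/lw.
  have : (u, v) <> (p, q) by case; move: wr; rewrite /within /=; lia.
  tauto.
split=> [Ruv|[->//|[/lw//|/rw//]]].
(* An arc in neither half has [u < c < v]: then [p < u] would cross [(p, c)] and [v < q] would cross
   [(c, q)]. *)
left; have := Rnc _ _ Ruv Rpc; have := Rnc _ _ Ruv Rcq; rewrite !crossingE.
have : ~ (c < v < q /\ u = p) by move=> [cv uE]; apply: (cmax v cv); rewrite -uE.
move: wuv nwl nwr; rewrite /within /= => wuv nwl nwr n1 n2 n3.
by congr pair; lia.
Qed.

(** * Infinite concatenation of finite paths *)

(** The paths are played one after another; [st k] is the stage at time [k]. Idle steps mark the
    passage to the next stage, so empty paths cause no trouble. *)
Lemma reach_concat T (E : nat -> T -> T -> Prop) (Inv : nat -> T -> Prop)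
    (S : nat -> T) :
  (forall j, Inv j (S j)) -> (forall j x y, Inv j x -> E j x y -> Inv j y) ->
  (forall j, reach (E j) (S j) (S j.+1)) ->
  exists (f : nat -> T) (st : nat -> nat),
    [/\ f 0 = S 0, (forall J, exists K, forall k, K <= k -> J <= st k),
        (forall k, Inv (st k) (f k))
      & forall k, f k.+1 = f k \/ E (st k) (f k) (f k.+1)].
Proof.
move=> InvS InvE hreach.
have /choice[pth hpth] : forall j, exists s : seq T,
    path (fun a b => `[< E j a b >]) (S j) s /\ last (S j) s = S j.+1.
  by move=> j; have [s sp sl] := hreach j; exists s.
(* A state is (current stage, sets still to visit in it, current set). *)
pose next (z : nat * seq T * T) :=
  let: (j, s, x) := z in
  if s is y :: s' then (j, s', y) else (j.+1, pth j.+1, x).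
pose state k := iter k next (0, pth 0, S 0).
have stateS k : state k.+1 = next (state k) by [].
pose good (z : nat * seq T * T) := let: (j, s, x) := z in
  [/\ path (fun a b => `[< E j a b >]) x s, last x s = S j.+1 & Inv j x].
have goodS k : good (state k).
  elim: k => [|k]; first by have [] := hpth 0.
  rewrite stateS; case: (state k) => [[j [|y s]] x] /=.
    by move=> [_ -> _]; have [] := hpth j.+1.
  by move=> [/andP[/asboolP xy ys] sl Ix]; split=> //; exact: InvE xy.
exists (fun k => (state k).2), (fun k => (state k).1.1); split=> //.
- move=> J.
  have [K KE] : exists K, state K = (J, pth J, S J).
    elim: J => [|J [K KE]]; first by exists 0.
    (* One step for each entry of the path, and one idle step to enter stage [J.+1]. *)
    exists ((size (pth J)).+1 + K).
    have iterE j s x : iter (size s) next (j, s, x) = (j, [::], last x s).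
      by elim: s x => //= y s IHs x; rewrite -iterS iterSr /= IHs.
    rewrite /state iterD -/(state K) KE iterS iterE /=.
    by have [_ ->] := hpth J.
  exists K => k; elim: k => [|k IHk]; first by rewrite leqn0 => /eqP <-; rewrite KE.
  rewrite leq_eqVlt => /predU1P[<-|]; first by rewrite KE.
  rewrite ltnS stateS => /IHk; case: (state k) => [[j [|y s]] x] //=; lia.
- by move=> k; have := goodS k; case: (state k) => [[j s] x] [].
- move=> k; have := goodS k; rewrite stateS; case: (state k) => [[j [|y s]] x] /=.
    by left.
  by move=> [/andP[/asboolP xy _] _ _]; right.
Qed.

Lemma infinite_nat_gt (A : set nat) :
  infinite_set A -> forall N, exists2 n, N < n & A n.
Proof.
move=> Ainf N; apply: contrapT => H; apply: Ainf; apply/finite_nat_bound.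
exists N.+1 => n An; rewrite ltnNge; apply/negP => Nn; apply: H; exists n => //.
Qed.

Lemma next_elements (A : set nat) : infinite_set A ->
  exists nx : nat -> nat, forall l,
    [/\ l < nx l, A (nx l) & forall k, l < k < nx l -> ~ A k].
Proof.
move=> Ainf; suff /choice[nx nxP] : forall l, exists n,
  [/\ l < n, A n & forall k, l < k < n -> ~ A k] by exists nx.
move=> l.
have exn : exists n, (l < n) && `[< A n >].
  have [n ln An] := infinite_nat_gt Ainf l.
  by exists n; rewrite ln (asboolT An).
case: (ex_minnP exn) => n /andP[ln /asboolP An] nmin; exists n; split=> // k lkn Ak.
by have := nmin k; rewrite (asboolT Ak); lia.
Qed.

(** * From mutations to fans that agree eventually *)

Lemma mutation_sim_fan_finite (R1 R2 : set (nat * nat)) :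
  R1 `<=` arcs -> noncrossing R1 -> mutation_sim R1 R2 ->
  exists N, forall n, N <= n -> (R1 (0, n) <-> R2 (0, n)).
Proof.
move=> Rarc Rnc [T [m [T0 Tm Tcv Tfin]]].
have Tnc k : T k `<=` arcs /\ noncrossing (T k).
  elim: k => [|k [Tarc Tn]]; first by rewrite T0.
  have := Tm k; case: (m k) => [g|-> //]; exact: mutation_noncrossing.
have [K TK] := (finite_nat_bound _).1 Tfin.
have [N TN] : exists N, forall n, N <= n -> (R1 (0, n) <-> T K (0, n)).
  elim: K {TK} => [|K [N TN]]; first by exists 0 => n _; rewrite T0.
  have := Tm K; case: (m K) => [g|->]; last by exists N.
  move=> /mutation_diff[g' [sub' sub]].
  (* Beyond the right ends of the removed and the added arc, the fan is unchanged. *)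
  exists (maxn N (maxn g.2 g'.2).+1) => n Nn; rewrite TN; last lia.
  split=> Tn.
    by apply: sub; split=> // gE; move: Nn; rewrite -gE /=; lia.
  by apply: sub'; split=> // gE; move: Nn; rewrite -gE /=; lia.
exists N => n /TN ->.
have stable k : K <= k -> (T k (0, n) <-> T K (0, n)).
  elim: k => [|k IH]; first by rewrite leqn0 => /eqP ->.
  rewrite leq_eqVlt => /predU1P[->//|]; rewrite ltnS => Kk; rewrite -IH //.
  have := Tm k; case mk: (m k) => [g|] Tg; last by rewrite Tg.
  have [Tarc Tn] := Tnc k.
  apply: mutation_fan Tarc Tn Tg _ _ => fg.
  by have : k < K; [apply: TK; exists g|lia].
(* At time [maxn K M] the arc [(0, n)] has its limiting status, and its status has been constant
   since time [K]. *)
have [M TM] := Tcv (0, n).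
have := stable _ (leq_maxl K M); have := TM _ (leq_maxr K M); tauto.
Qed.

(** * From fans that agree eventually to mutations, block by block *)

Lemma fan_finite_mutation_sim (R1 R2 : set (nat * nat)) N :
  right_fountain R1 -> right_fountain R2 ->
  (forall n, N <= n -> (R1 (0, n) <-> R2 (0, n))) -> mutation_sim R1 R2.
Proof.
move=> [R1t R1inf] [R2t _] fanE.
have [R1arc R1nc _] := R1t; have [R2arc R2nc _] := R2t.
have [M NM RM] := infinite_nat_gt R1inf N.
have [nx nxP] := next_elements R1inf.
(* The cut points: [0], then [M], then the successive fan points of [R1] after [M], which are also
   those of [R2]. *)
pose L j := if j is j'.+1 then iter j' nx M else 0.
have L1 j : [/\ N < L j.+1, R1 (0, L j.+1) & R2 (0, L j.+1)].
  suff [NL R1L] : N < L j.+1 /\ R1 (0, L j.+1).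
    by split=> //; apply/fanE => //; exact: ltnW.
  elim: j => [//|j [NL R1L]]; have [lt R1n _] := nxP (L j.+1).
  by split=> //; exact: ltn_trans lt.
have Llt j : L j < L j.+1.
  case: j => [|j]; last by have [] := nxP (L j.+1).
  by have [+ _ _] := L1 0; exact: leq_ltn_trans.
have Lmono i j : i <= j -> L i <= L j.
  elim: j => [|j IH]; first by rewrite leqn0 => /eqP ->.
  by rewrite leq_eqVlt => /predU1P[->//|/IH]; have := Llt j; lia.
have Lge j : j <= L j by elim: j => [|j IH] //; have := Llt j; lia.
have Lgap j k : L j.+1 < k < L j.+2 -> ~ R1 (0, k).
  by have [_ _] := nxP (L j.+1); exact.
have L0 : L 0 = 0 by [].
clearbody L.
have RL j : R1 (L j, L j.+1) /\ R2 (L j, L j.+1).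
  have [NL R1L R2L] := L1 j; case: j => [|j] in NL R1L R2L *; first by rewrite L0.
  have [NLj R1Lj R2Lj] := L1 j.
  split; first exact: triangulation_triangle R1t R1L R1Lj (Llt _) (@Lgap j).
  apply: triangulation_triangle R2t R2L R2Lj (Llt _) _ => k kj.
  by move/fanE => R1k; apply: (Lgap j k kj); apply: R1k; lia.
(* Target at the start of stage [j]: the blocks up to [L j] are already those of [R2]. During the
   stage, [Inv] lets only block [j] deviate. *)
pose S j : set (nat * nat) := [set g | if g.2 <= L j then R2 g else R1 g].
pose W j := within (L j) (L j.+1).
pose Inv j (R : set (nat * nat)) := forall g, ~ W j g -> (R g <-> S j g).
have reachS j : reach (flip (L j) (L j.+1)) (S j) (S j.+1).
  have [R1L R2L] := RL j.
  have [t1 [t1L t1E]] := triangulation_tree R1t R1L.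
  have [t2 [t2L t2E]] := triangulation_tree R2t R2L.
  apply: (@polygon_flip_connected t1 t2).
  - split=> // -[u v] wuv; rewrite -t1E // /S /=.
    by case: ifP => //; move: wuv; rewrite /within /=; lia.
  - split=> // -[u v] wuv; rewrite -t2E // /S /=.
    by case: ifP => //; move: wuv; rewrite /within /=; lia.
  - move=> [u v] nw; rewrite /S /=; have Lj := Llt j.
    have [vj|vj] := leqP v (L j); first by rewrite ifT //; lia.
    have [vj'|vj'] := leqP v (L j.+1); last by split.
    have [uv|vu] := ltnP u v; last first.
      by split=> [/R1arc|/R2arc]; rewrite /arcs /=; lia.
    case: j => [|j] in R1L R2L t1L t1E t2L t2E nw Lj vj vj' *.
      by exfalso; apply: nw; rewrite /within /= L0 uv vj'.
    have [NLj R1Lj R2Lj] := L1 j.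
    (* Outside the block, an arc ending in it either starts at [0], where the fans agree, or crosses
       the fan arc to the left end of the block. *)
    have [->|u0] := eqVneq u 0; first by apply: fanE; lia.
    have uL : u < L j.+1.
      by rewrite ltnNge; apply/negP => Lu; apply: nw; rewrite /within /=; lia.
    by split=> [/(R1nc _ _ R1Lj)|/(R2nc _ _ R2Lj)]; rewrite crossingE; lia.
have [||f [st [f0 stinf fInv fE]]] := reach_concat (Inv := Inv) _ _ reachS.
- by move=> j g _.
- by move=> j x y Ix [_ xy] g nw; rewrite -xy //; exact: Ix.
have /choice[m mP] : forall k, exists o : option (nat * nat),
    match o with
    | Some g => [/\ mutation (f k) g (f k.+1), W (st k) g &
                  g <> (L (st k), L (st k).+1)]
    | None => f k.+1 = f k
    end.
  by move=> k; case: (fE k) => [fk|[[g gP] _]]; [exists None|exists (Some g)].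
exists f, m; split.
- rewrite f0; apply/funext => -[u v]; apply/propext; rewrite /S /=.
  by rewrite L0; case: ifP => // v0; split=> [/R2arc|/R1arc]; rewrite /arcs /=; lia.
- by move=> k; have := mP k; case: (m k) => [g []|].
- move=> [u v]; have [K stK] := stinf v; exists K => k /stK vst.
  (* Since [j <= L j], an arc ending at [v] is settled once stage [v] is reached. *)
  have vL : v <= L (st k) by apply: leq_trans (Lge _) (Lmono _ _ vst).
  rewrite (fInv k) /S /= ?vL // /W /within /=; lia.
(* Stage [0] is over by time [K]. Later blocks avoid [0] and have fan points only at their two ends,
   so a fountain arc inside would be the excluded outer side. *)
- have [K stK] := stinf 1; apply/finite_nat_bound; exists K => k [g mk].
  have := mP k; rewrite mk => -[_ Wg gn] [n yE].
  rewrite ltnNge; apply/negP => /stK; have := fInv k; move: Wg gn.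
  case: (st k) => // j Wg gn If _; have [NL R1L _] := L1 j.
  have ends l : L j.+1 <= l <= L j.+2 -> f k (0, l) -> l = L j.+1 \/ l = L j.+2.
    move=> lL; rewrite If /S /=; last by rewrite /W /within /=; lia.
    case: ifP => lj; first by left; lia.
    move=> R1l; right; apply: contrapT => lj'; apply: (Lgap j l) R1l; lia.
  (* The default value [0] of [yseq] is allowed for here; it is ruled out because [0] lies outside
     the block. *)
  have yfan i : yseq (f k) i = 0 \/ f k (0, yseq (f k) i).
    by rewrite /yseq; case: xgetP => [l _ []|]; [right|left].
  case: yE Wg gn => ->; rewrite /W /within /=; first by lia.
  set y := yseq _ n; set y' := yseq _ n.+1 => Wy.
  have := yfan n; have := yfan n.+1; rewrite -/y -/y'.
  case=> [|/ends y'L]; first by lia.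
  case=> [|/ends yL]; first by lia.
  by apply; congr pair; lia.
Qed.

Theorem theorem3p15 (R1 R2 : set (nat * nat))
    (hR1 : right_fountain R1) (hR2 : right_fountain R2) :
  mutation_sim R1 R2 <->
  finite_set [set n | 1 <= n /\ xseq R1 n <> xseq R2 n].
Proof.
split=> [sim|/finite_nat_bound[N xE]].
  have [[R1arc R1nc _] _] := hR1.
  have [N fanE] := mutation_sim_fan_finite R1arc R1nc sim.
  apply/finite_nat_bound; exists N => n [_ xn]; rewrite ltnNge; apply/negP => Nn.
  apply: xn; rewrite /xseq; congr (if _ then _ else _); apply: asbool_equiv_eq.
  by apply: fanE; lia.
(* [xseq] at [n] concerns [(0, n.+1)]; the bound [N.+2] ensures both [N <= n] and [1 <= n]. *)
apply: (fan_finite_mutation_sim (N := N.+2)) => // -[|n] // Nn.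
have : xseq R1 n = xseq R2 n.
  by apply: contrapT => xn; have : n < N; [apply: xE; split=> //; lia|lia].
rewrite /xseq; case: asboolP => r1; case: asboolP => r2 //; tauto.
Qed.
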